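(* Let $k\ge1$ be an integer. The correspondence $$\lambda\mapsto\mu_\lambda=\prod_{b:\ \text{box of }\lambda}(2g-2s_b+t_b)$$ defines an injective mapping from the set of all Young diagrams $\lambda$ with $k$ boxes into the space of polynomials of degree $k$ in the variable $g$.
   Context: For a box $b$ of a Young diagram $\lambda$, $s_b$ is the number of columns of $\lambda$ to the left of the column containing $b$, and $t_b$ is the number of rows of $\lambda$ above the row containing $b$. Here $g$ is a formal variable. *)

(* Defs.v *)
From HB Require Import structures.
From mathcomp Require Import all_boot all_order all_algebra.
Set Implicit Arguments.
Unset Strict Implicit.
Unset Printing Implicit Defensive.
Import GRing.Theory.
Local Open Scope ring_scope.

(* A Young diagram is given by the lengths of its rows, listed from top to    *)
(* bottom: weakly decreasing and nonzero, so that distinct lists are distinct *)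
(* diagrams.                                                                  *)
Record young_diagram (k : nat) := YoungDiagram {
  rows :> seq nat;
  _ : [&& sorted geq rows, 0%N \notin rows & sumn rows == k]
}.

HB.instance Definition _ (k : nat) := [isSub for @rows k].
HB.instance Definition _ (k : nat) := [Equality of young_diagram k by <:].

(* The box (i, j) lies in row i and column j, both numbered from 0. *)
Definition boxes (la : seq nat) : seq (nat * nat) :=
  [seq (i, j) | i <- iota 0 (size la), j <- iota 0 (nth 0%N la i)].

(* The columns of a diagram are indexed by the boxes of its top row. *)
Definition columns_left (la : seq nat) (b : nat * nat) : nat :=
  count (fun j => (j < b.2)%N) (iota 0 (head 0%N la)).

Definition rows_above (la : seq nat) (b : nat * nat) : nat :=
  count (fun i => (i < b.1)%N) (iota 0 (size la)).

Definition mu (F : fieldType) (k : nat) (la : young_diagram k) : {poly F} :=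
  \prod_(b <- boxes la)
    (2%:R * 'X - 2%:R * (columns_left la b)%:R + (rows_above la b)%:R).

(* Main.v *)
Require Import Defs.
From mathcomp Require Import all_boot all_order all_algebra.
From mathcomp Require Import zify ring.
Set Implicit Arguments.
Unset Strict Implicit.
Unset Printing Implicit Defensive.
Import GRing.Theory.
Local Open Scope ring_scope.

(** The boxes on the line [2 * j - i = c] are obtained from one another by the
steps (two rows down, one column right), so those lying in a diagram form an
initial segment of the line, which is determined by its cardinality.  That
cardinality is the multiplicity of the root [c / 2] of [mu]. *)

Lemma count_ltn_iota (m n : nat) :
  (m <= n)%N -> count (fun i => (i < m)%N) (iota 0 n) = m.
Proof.
move=> lemn; rewrite -(subnKC lemn) iotaD count_cat add0n.
rewrite (eq_in_count (a2 := predT)); last by move=> i; rewrite mem_iota.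
rewrite count_predT size_iota (eq_in_count (a2 := pred0)) ?count_pred0 ?addn0 //.
by move=> i; rewrite mem_iota /= => /andP[lemi _]; rewrite ltnNge lemi.
Qed.

(** The default value 0 of [nth] gives length 0 to rows past the last one, so [j < nth 0 la i]
    already forces [i < size la]. *)
Lemma mem_boxes (la : seq nat) (i j : nat) :
  ((i, j) \in boxes la) = (j < nth 0 la i)%N.
Proof.
apply/allpairsPdep/idP => [[i' [j' [_ Hj [-> ->]]]]|lt_j].
  by move: Hj; rewrite mem_iota.
exists i, j; rewrite !mem_iota !add0n; split=> //.
by rewrite /= ltnNge; apply: contraL lt_j => /(nth_default 0%N) ->.
Qed.

Lemma boxes_uniq (la : seq nat) : uniq (boxes la).
Proof.
apply: allpairs_uniq_dep; first exact: iota_uniq.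
  by move=> i _; apply: iota_uniq.
by move=> [i j] [i' j'] _ _ /= [-> ->].
Qed.

Lemma size_boxes (la : seq nat) : size (boxes la) = sumn la.
Proof.
rewrite size_allpairs_dep; congr sumn.
under eq_map do rewrite size_iota.
by rewrite -[RHS](mkseq_nth 0%N).
Qed.

Section Diagram.

Variables (k : nat) (la : young_diagram k).

Lemma diagram_nth_geq (i j : nat) : (i <= j)%N -> (nth 0 la j <= nth 0 la i)%N.
Proof.
case: la => s /= /and3P[srt _ _] leij.
have [ltj|] := ltnP j (size s); last by move/(nth_default 0%N)->.
have geq_trans : transitive geq by move=> p m n /= lepm /leq_trans; apply.
apply: (sorted_leq_nth geq_trans leqnn 0%N srt) => //.
exact: leq_ltn_trans ltj.
Qed.

Lemma diagram_nth_gt0 (i : nat) : (0 < nth 0 la i)%N = (i < size la)%N.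
Proof.
case: la => s /= /and3P[_ s0 _].
have [lti|] := ltnP i (size s); last by move/(nth_default 0%N)->.
by rewrite lt0n; apply: contraNneq s0 => <-; apply: mem_nth.
Qed.

Lemma boxes_down (i j i' j' : nat) : (i' <= i)%N -> (j' <= j)%N ->
  (i, j) \in boxes la -> (i', j') \in boxes la.
Proof.
move=> lei lej; rewrite !mem_boxes => ltj.
exact: leq_ltn_trans lej (leq_trans ltj (diagram_nth_geq lei)).
Qed.

Lemma columns_leftE b : b \in boxes la -> columns_left la b = b.2.
Proof.
(* The box moved up to row 0 is still a box, so its column index is less than the length of the top
   row. *)
case: b => i j /(boxes_down (leq0n i) (leqnn j)).
by rewrite mem_boxes nth0 => /ltnW/count_ltn_iota.
Qed.

Lemma rows_aboveE b : b \in boxes la -> rows_above la b = b.1.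
Proof.
case: b => i j; rewrite mem_boxes => /(leq_ltn_trans (leq0n j)).
by rewrite diagram_nth_gt0 => /ltnW/count_ltn_iota.
Qed.

Lemma size_boxes_diagram : size (boxes la) = k.
Proof. by rewrite size_boxes; case: la => s /= /and3P[_ _ /eqP]. Qed.

End Diagram.

(** Equality of [2 * j - i] at the two boxes, rearranged to avoid truncated subtraction. *)
Definition same_line (b b' : nat * nat) : bool :=
  (2 * b'.2 + b.1 == 2 * b.2 + b'.1)%N.

(** If a box [(i, j)] of [la] were missing from [la'], all boxes of [la'] on its line would be boxes
    of [la]; with equal counts both diagrams would meet the line in the same boxes, yet only [la]
    has [(i, j)]. *)
Lemma boxes_sub_of_line_count (k : nat) (la la' : young_diagram k) :
  (forall b, count (same_line b) (boxes la) = count (same_line b) (boxes la')) ->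
  {subset boxes la <= boxes la'}.
Proof.
move=> eq_cnt [i j] la_b; apply/negPn/negP => la'_b.
have line_sub : {subset filter (same_line (i, j)) (boxes la')
                 <= filter (same_line (i, j)) (boxes la)}.
  move=> [i' j']; rewrite !mem_filter => /andP[line_b' la'_b'].
  (* Rows and columns grow together along the line: either [(i, j)] is up and left of [(i', j')],
     hence in [la'], or [(i', j')] is up and left of [(i, j)], hence in [la]. *)
  rewrite line_b'; have [lej|ltj] := leqP j j'.
    case/negP: la'_b; apply: boxes_down la'_b' => //.
    by move: line_b'; rewrite /same_line /=; lia.
  apply: boxes_down la_b; last exact: ltnW.
  by move: line_b'; rewrite /same_line /=; lia.
have [|_ eq_line] := uniq_min_size (filter_uniq _ (boxes_uniq la')) line_sub.
  by rewrite !size_filter eq_cnt.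
case/negP: la'_b; have := eq_line (i, j).
by rewrite !mem_filter la_b /same_line eqxx.
Qed.

Lemma diagram_eq_boxes (k : nat) (la la' : young_diagram k) :
  boxes la =i boxes la' -> la = la'.
Proof.
move=> eq_b; apply: val_inj => /=.
have eq_nth i : nth 0%N la i = nth 0%N la' i.
  apply/eqP; rewrite eqn_leq; apply/andP.
  (* Were row [i] longer in one diagram, the position just past the shorter row would be a box of
     only one of them. *)
  split; rewrite leqNgt -mem_boxes; first by rewrite eq_b mem_boxes ltnn.
  by rewrite -eq_b mem_boxes ltnn.
apply: (@eq_from_nth _ 0%N) => [|i _]; last exact: eq_nth.
(* Rows are nonempty, so the number of rows is the first index where [nth] gives 0. *)
apply/eqP; rewrite eqn_leq; apply/andP.
split; rewrite leqNgt -diagram_nth_gt0; first by rewrite eq_nth diagram_nth_gt0 ltnn.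
by rewrite -eq_nth diagram_nth_gt0 ltnn.
Qed.

Section Roots.

Variables (F : fieldType) (charF : [pchar F] =i pred0).

Lemma natr_inj_pchar0 : injective (fun n : nat => n%:R : F).
Proof.
have natr0 := (pcharf0P F).1 charF.
suff le_eq (m n : nat) : (m <= n)%N -> m%:R = n%:R :> F -> m = n.
  move=> m n; have [/le_eq//|/ltnW/le_eq le_eq' eq_mn] := leqP m n.
  by rewrite le_eq'.
move=> lemn /eqP; rewrite eq_sym -subr_eq0 -natrB // natr0 => le0.
by apply/eqP; rewrite eqn_leq lemn.
Qed.

Lemma two_neq0_pchar0 : 2%:R != 0 :> F.
Proof. by rewrite ((pcharf0P F).1 charF). Qed.

(** The zero of the factor [2 * 'X - 2 * j + i] of the box [(i, j)]. *)
Definition box_root (b : nat * nat) : F := b.2%:R - b.1%:R / 2%:R.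

Lemma box_root_eq b b' : (box_root b' == box_root b) = same_line b b'.
Proof.
rewrite /same_line -(inj_eq natr_inj_pchar0) /=.
rewrite (natrD F (2 * b'.2)%N) (natrD F (2 * b.2)%N) !natrM.
have nz2 := two_neq0_pchar0.
(* Twice the difference of the roots is the difference of the two sides of the line equation. *)
rewrite -(inj_eq (mulfI nz2)) -subr_eq0 -[RHS]subr_eq0; congr (_ == 0).
by rewrite /box_root; field.
Qed.

Lemma mu_roots (k : nat) (la : young_diagram k) :
  mu F la = 2%:R ^+ k *: \prod_(x <- map box_root (boxes la)) ('X - x%:P).
Proof.
have nz2 := two_neq0_pchar0.
(* [2 ^+ k] becomes a product of 2 over the boxes, to be merged factor by factor with the monic
   product. *)
rewrite -[X in _ ^+ X](size_boxes_diagram la) -iter_mulr_1 -count_predT -big_const_seq.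
rewrite big_map -scaler_prod /mu big_seq [RHS]big_seq.
apply: eq_bigr => b la_b; rewrite columns_leftE // rows_aboveE //.
rewrite scalerBr -mul_polyC -[_ *: _%:P]mul_polyC -!polyCM /box_root mulrBr.
rewrite (mulrC _ (_ / _)) divfK // polyCB polyCM !polyC_natr.
by rewrite opprB addrA addrAC.
Qed.

End Roots.

Theorem theorem1p6 (F : fieldType) (charF : [pchar F] =i pred0)
    (k : nat) (hk : (1 <= k)%N) :
  (forall la : young_diagram k, size (mu F la) = k.+1) /\
  injective (fun la : young_diagram k => mu F la).
Proof.
have nz2k : 2%:R ^+ k != 0 :> F by rewrite expf_neq0 ?two_neq0_pchar0.
split=> [la|la la' /eqP].
  by rewrite (mu_roots charF) size_scale // size_prod_XsubC size_map size_boxes_diagram.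
rewrite !(mu_roots charF) (inj_eq (scalerI nz2k)) => /eqP/prod_XsubC_eq/permP eq_cnt.
have eq_line b :
    count (same_line b) (boxes la) = count (same_line b) (boxes la').
  (* The multiplicity of the root of [b] counts the boxes on its line. *)
  have := eq_cnt (pred1 (box_root F b)); rewrite !count_map.
  by rewrite !(eq_count (box_root_eq charF b)).
apply: diagram_eq_boxes => b; apply/idP/idP; exact: boxes_sub_of_line_count.
Qed.
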